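(* Let $k\in\mathbb{N}$ and let $D_1,\dots,D_k$ be oriented graphs such that $\operatorname{inv}(D_i)\leq 2$ for all $i$, with equality for at most one $i$. Then \[\operatorname{inv}([D_1,\dots,D_k])=\sum_{i=1}^k\operatorname{inv}(D_i).\]
   Context: All digraphs are oriented graphs: directed graphs without loops, digons or parallel edges. For a digraph $D$ and $X\subseteq V(D)$, inverting $X$ in $D$ means reversing the direction of every edge with both endpoints in $X$. A family $X_1,\dots,X_k\subseteq V(D)$ is a decycling family of $D$ if inverting $X_1,\dots,X_k$ in turn yields an acyclic digraph; $\operatorname{inv}(D)$ is the minimum size of a decycling family of $D$. The $k$-join $[D_1,\dots,D_k]$ is the digraph consisting of vertex-disjoint copies of $D_1,\dots,D_k$ together with an edge $\vec{uv}$ whenever $u\in V(D_i)$, $v\in V(D_j)$ with $i<j$. *)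

(* Defs.v *)
From mathcomp Require Import all_boot.
Set Implicit Arguments.
Unset Strict Implicit.
Unset Printing Implicit Defensive.

(* Arcs form a relation, so parallel edges are excluded by construction. *)
Record ograph (V : finType) := OGraph {
  arc :> rel V;
  arc_irr : irreflexive arc;
  arc_asym : forall u v, arc u v -> ~~ arc v u }.

Section Inversion.
Variable V : finType.
Implicit Types (D : ograph V) (X : {set V}) (Xs : seq {set V}).

Definition invert_arc D X : rel V :=
  fun u v => if (u \in X) && (v \in X) then arc D v u else arc D u v.

Fact invert_irr D X : irreflexive (invert_arc D X).
Proof. by move=> u; rewrite /invert_arc arc_irr if_same. Qed.

Fact invert_asym D X u v : invert_arc D X u v -> ~~ invert_arc D X v u.
Proof. by rewrite /invert_arc andbC; case: ifP => _; apply: arc_asym. Qed.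

Definition invert D X : ograph V := OGraph (invert_irr D X) (@invert_asym D X).

Definition invert_seq D Xs : ograph V := foldl invert D Xs.

(* The nonempty sequences c with ucycle D c are the directed cycles of D. *)
Definition acyclic D : Prop := forall c : seq V, ucycle D c -> c = [::].

Definition decycling D Xs : Prop := acyclic (invert_seq D Xs).

(* A boolean form of acyclicity, used only to take a minimum with ex_minn. *)
Definition acyclicb D : bool :=
  [forall u, forall v, arc D u v ==> ~~ connect D v u].

Lemma acyclicP D : reflect (acyclic D) (acyclicb D).
Proof.
apply: (iffP forallP) => [acD [|u p] //|acD u].
  case/andP=> /=; rewrite rcons_path => /andP[pathp lastp] _.
  have /forallP/(_ u) := acD (last u p).
  by rewrite lastp /= => /negP[]; apply/connectP; exists p.
apply/forallP=> v; apply/implyP=> uv; apply/negP=> /connectP[p pathp eu].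
move: eu uv; case/shortenP: pathp => q pathq uniq_q _ -> uv.
suff : v :: q = [::] by [].
by apply: acD; rewrite /ucycle /= rcons_path pathq uv.
Qed.

Definition inv_le D n : bool :=
  [exists Xs : n.-tuple {set V}, acyclicb (invert_seq D Xs)].

Lemma inv_leP D n :
  reflect (exists2 Xs : seq {set V}, size Xs = n & decycling D Xs) (inv_le D n).
Proof.
apply: (iffP existsP) => [[Xs /acyclicP acD]|[Xs /eqP sXs acD]].
  by exists Xs; rewrite ?size_tuple.
by exists (Tuple sXs); apply/acyclicP.
Qed.

Let back D : {set V * V} :=
  [set p | arc D p.1 p.2 && (enum_rank p.2 < enum_rank p.1)].

Lemma decycling_exists D : exists n, inv_le D n.
Proof.
suff [Xs acD] : exists Xs, decycling D Xs.
  by exists (size Xs); apply/inv_leP; exists Xs.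
have [m] := ubnP #|back D|; elim: m D => // m IHm D ltDm.
have [back0|[[u v] uv]] := set_0Vmem (back D).
  exists [::]; apply/acyclicP/forallP=> u; apply/forallP=> v.
  have leD x y : arc D x y -> enum_rank x <= enum_rank y.
    move=> xy; rewrite leqNgt; apply/negP=> lt_yx.
    by have := in_set0 (x, y); rewrite -back0 inE xy lt_yx.
  apply/implyP=> uv; apply/negP=> /connectP[p pathp eu].
  have : enum_rank v <= enum_rank u.
    rewrite eu; elim: p v pathp {uv eu} => //= w p IHp v /andP[vw /IHp].
    by apply: leq_trans; apply: leD.
  rewrite leq_eqVlt => /orP[/eqP/val_inj/enum_rank_inj evu|].
    by rewrite evu arc_irr in uv.
  by rewrite ltnNge leD.
have [|Xs acXs] := IHm (invert D [set u; v]); last by exists ([set u; v] :: Xs).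
apply: leq_trans (ltDm : #|back D| <= m); apply: proper_card.
have /[!inE]/andP[/= Duv ltvu] := uv.
apply/properP; split; last first.
  exists (u, v) => //; rewrite inE /= /invert_arc !inE !eqxx orbT /=.
  by rewrite (negPf (arc_asym Duv)).
apply/subsetP=> -[x y] /[!inE] /= /andP[+ ltyx]; rewrite ltyx andbT.
rewrite /invert_arc !inE; case: ifP => // /andP[/orP[]/eqP ex /orP[]/eqP ey];
  move: ltyx; rewrite ex ey ?ltnn // => ltuv.
by rewrite ltnNge ltnW in ltuv.
Qed.

Definition inversion_number D : nat := ex_minn (decycling_exists D).

Lemma inversion_number_decycling D : exists2 Xs, size Xs = inversion_number D & decycling D Xs.
Proof. by rewrite /inversion_number; case: ex_minnP => n /inv_leP. Qed.

Lemma inversion_number_min D Xs : decycling D Xs -> inversion_number D <= size Xs.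
Proof.
move=> acD; rewrite /inversion_number; case: ex_minnP => n _; apply.
by apply/inv_leP; exists Xs.
Qed.

End Inversion.

Section Join.
Variables (k : nat) (V : 'I_k -> finType) (D : forall i, ograph (V i)).

(* A vertex of the join is a pair of an index i and a vertex of D i; when the
   indices of u and v agree, tagged_as u v is v seen as a vertex of the copy
   that contains u. *)
Definition join_arc : rel {i : 'I_k & V i} :=
  fun u v => if tag u == tag v then arc (D (tag u)) (tagged u) (tagged_as u v)
             else tag u < tag v.

Fact join_irr : irreflexive join_arc.
Proof. by case=> i x; rewrite /join_arc eqxx tagged_asE arc_irr. Qed.

Fact join_asym u v : join_arc u v -> ~~ join_arc v u.
Proof.
case: u v => [i x] [j y]; rewrite /join_arc /= [j == i]eq_sym.
case: eqP => [eij|_ ltij]; last by rewrite -leqNgt ltnW.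
by move: y; rewrite -eij => y; rewrite !tagged_asE; apply: arc_asym.
Qed.

Definition kjoin : ograph {i : 'I_k & V i} := OGraph join_irr join_asym.

End Join.

(* Main.v *)
Require Import Defs.
From HB Require Import structures.
From mathcomp Require Import all_boot all_algebra.
From mathcomp Require Import zify.
Set Implicit Arguments.
Unset Strict Implicit.
Unset Printing Implicit Defensive.

(* A decycling family of size m assigns to each vertex v its incidence vector
   x v in F_2^m, and the arc uv is reversed iff <x u, x v> = 1.  Together with a
   topological order of the resulting acyclic digraph, this makes sense for any
   symmetric bilinear form over F_2, and then the rank of the form is at least
   the sum of the inversion numbers.  This is shown by induction, removing one or
   two components at a time.  If u, v lie in the same component and z in another
   one, then <x u + x v, x z> = 1 iff z lies between u and v in the order.  Hence
   projecting orthogonally to such a vector, or to a hyperbolic pair of them,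
   changes the form on the other components by indicators of intervals, and
   these changes are realised by reversing or exchanging intervals of the order.
   Suppose that no component of inversion number 1 can be removed in this way.
   One of them, D_i, then spans an interval meeting no other component except
   possibly the one of inversion number 2; the differences of its vectors are
   totally isotropic, and it meets at least three gaps left by that component, for
   otherwise D_i would be acyclic.  So the differences contain a totally isotropic
   plane orthogonal to all other components, and the rank drops by 4 when these
   two components, which contribute 3 to the sum, are removed. *)

(* Locked, as unification would otherwise compute with matrix products. *)
HB.lock Definition bform (N : nat) (B : 'M['F_2]_N) (u v : 'rV['F_2]_N) : bool :=
  ((u *m B *m v^T) 0 0 != 0)%R.

(** * Bilinear forms over F_2 and rank-lowering projections *)

Section SymmetricForm.
Import GRing.Theory.
Local Open Scope ring_scope.

(** With [P = 1 - A y x] one has [P A y = 0], so Frobenius' inequality gives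
    [rank (P A) + rank (A y) <= rank A], and [A y] is nonzero. *)
Lemma wedderburn_rank (F : fieldType) m n (A : 'M[F]_(m, n)) (x : 'rV_m) (y : 'cV_n) :
  x *m A *m y = 1%:M -> (\rank (A - A *m y *m x *m A)%R < \rank A)%N.
Proof.
move=> xAy.
have := mxrank_Frobenius (1%:M - A *m y *m x) A y.
have -> : (1%:M - A *m y *m x) *m A = A - A *m y *m x *m A.
  by rewrite mulmxBl mul1mx.
rewrite mulmxBl -!mulmxA (mulmxA x) xAy mulmx1 subrr mxrank0 addn0.
have : A *m y != 0.
  by apply: contra_eq_neq xAy => Ay0; rewrite -mulmxA Ay0 mulmx0 eq_sym oner_neq0.
rewrite -mxrank_eq0 -lt0n; lia.
Qed.

Lemma F2_neq0D (a b : 'F_2) : (a + b != 0) = (a != 0) (+) (b != 0).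
Proof. by case: a b => [[|[|]] //= ?] [[|[|]] //= ?]. Qed.

Lemma F2_neq0 (a : 'F_2) : a = (a != 0)%:R.
Proof. by apply/val_inj; case: a => [[|[|]] //= ?]. Qed.

Variable N : nat.
Implicit Types (B : 'M['F_2]_N) (u v w d e : 'rV['F_2]_N).

Lemma bformE B u v : bform B u v = ((u *m B *m v^T) 0 0 != 0).
Proof. by rewrite bform.unlock. Qed.

Lemma bform_mx B u v : u *m B *m v^T = (bform B u v)%:R%:M.
Proof. by rewrite bformE [LHS]mx11_scalar -F2_neq0. Qed.

Lemma bformC B u v : B^T = B -> bform B u v = bform B v u.
Proof.
move=> sB; rewrite !bformE -[in LHS](trmxK (u *m B *m v^T)) mxE.
by rewrite !trmx_mul sB trmxK mulmxA.
Qed.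

Lemma bformDl B u v w : bform B (u + v) w = bform B u w (+) bform B v w.
Proof. by rewrite !bformE !mulmxDl mxE F2_neq0D. Qed.

Lemma bformDr B u v w : bform B w (u + v) = bform B w u (+) bform B w v.
Proof. by rewrite !bformE linearD mulmxDr mxE F2_neq0D. Qed.

Lemma bform0 u v : bform 0 u v = false.
Proof. by rewrite bformE mulmx0 mul0mx mxE eqxx. Qed.

Lemma F2_oppr (a : 'F_2) : - a = a.
Proof. by apply/val_inj; case: a => [[|[|]] //= ?]. Qed.

Lemma oppmx_F2 m n (A : 'M['F_2]_(m, n)) : - A = A.
Proof. by apply/matrixP => i j; rewrite mxE F2_oppr. Qed.

Lemma bform_sym B : (forall u v, bform B u v = bform B v u) -> B^T = B.
Proof.
have BE i j : B i j = (bform B (delta_mx 0 i) (delta_mx 0 j))%:R.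
  by rewrite bformE -F2_neq0 -rowE trmx_delta -colE !mxE.
by move=> sB; apply/matrixP => i j; rewrite mxE !BE sB.
Qed.

Lemma bform_wedderburn B d e : bform B d e ->
  exists2 B', (\rank B' < \rank B)%N &
    forall u v, bform B' u v = bform B u v (+) (bform B u e && bform B d v).
Proof.
move=> de; exists (B - B *m e^T *m d *m B).
  by apply: wedderburn_rank; rewrite bform_mx de.
move=> u v; rewrite oppmx_F2 [LHS]bformE mulmxDr mulmxDl mxE F2_neq0D -bformE; congr (_ (+) _).
rewrite !mulmxA (bform_mx B u e) mul_scalar_mx -!scalemxAl bform_mx !mxE eqxx.
by case: bform; case: bform.
Qed.

Lemma bform_reduce1 B d : B^T = B -> bform B d d ->
  exists B', [/\ B'^T = B', (\rank B' < \rank B)%N &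
    forall u v, bform B' u v = bform B u v (+) (bform B d u && bform B d v)].
Proof.
move=> sB /bform_wedderburn[B' ltB' B'E]; have sBE u v := bformC u v sB.
exists B'; split=> [|//|u v]; last by rewrite B'E (sBE u d).
by apply: bform_sym => u v; rewrite !B'E (sBE u v) (sBE u d) (sBE v d) andbC.
Qed.

(** Two rank-one updates, for the pairs [(d, e)] and [(e, d)]; as [d] is isotropic, the first leaves
    the value at [(e, d)] equal to 1. The last term accounts for an anisotropic [e]. *)
Lemma bform_reduce2 B d e : B^T = B -> ~~ bform B d d -> bform B d e ->
  exists B', [/\ B'^T = B', (\rank B' + 2 <= \rank B)%N &
    forall u v, bform B' u v =
      bform B u v (+) (bform B d u && bform B e v) (+) (bform B e u && bform B d v)
      (+) [&& bform B e e, bform B d u & bform B d v]].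
Proof.
move=> sB /negPf dd de; have sBE u v := bformC u v sB.
have [B1 lt1 B1E] := bform_wedderburn de.
have [|B2 lt2 B2E] := @bform_wedderburn B1 e d.
  by rewrite B1E dd andbF addbF sBE.
have {}B2E u v : bform B2 u v =
    bform B u v (+) (bform B d u && bform B e v) (+) (bform B e u && bform B d v)
    (+) [&& bform B e e, bform B d u & bform B d v].
  rewrite B2E !B1E dd andbF addbF (sBE u d) (sBE u e).
  by do 6!case: bform.
exists B2; split=> [||//]; last by lia.
apply: bform_sym => u v; rewrite !B2E (sBE v u).
by do 6!case: bform.
Qed.

End SymmetricForm.

(** * Acyclicity and topological orders *)

Section Acyclic.
Variables (V : finType) (D : ograph V).

Lemma acyclic_of_pos (f : V -> nat) :
  (forall u v, D u v -> f u < f v) -> acyclic D.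
Proof.
move=> fD; apply/acyclicP/forallP=> u; apply/forallP=> v; apply/implyP=> uv.
apply/negP=> /connectP[p pathp eu].
suff : f v <= f u by rewrite leqNgt fD.
rewrite eu; elim: p v pathp {uv eu} => //= w p IHp v /andP[vw /IHp].
by apply: leq_trans; apply/ltnW/fD.
Qed.

Lemma pos_of_acyclic : acyclic D ->
  exists2 pos : V -> nat, injective pos & forall u v, D u v -> pos u < pos v.
Proof.
move=> /acyclicP/forallP acD.
pose anc v := #|[set w | connect D w v]|.
(* The number of ancestors increases along arcs; the remainder [enum_rank v] modulo [#|V|] makes the
   positions distinct. *)
exists (fun v => anc v * #|V| + enum_rank v) => [u v eq_uv|u v uv].
  apply/enum_rank_inj/val_inj; have := congr1 (modn^~ #|V|) eq_uv.
  by rewrite !modnMDl !modn_small ?ltn_ord.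
have ltuv : anc u < anc v.
  apply/proper_card/properP; split.
    by apply/subsetP=> w /[!inE] wu; apply: connect_trans wu (connect1 uv).
  exists v; rewrite inE ?connect0 //.
  by have /forallP/(_ v) := acD u; rewrite uv.
apply: (@leq_trans ((anc u).+1 * #|V|)); first by rewrite mulSn addnC ltn_add2r.
by apply: leq_trans (leq_addr _ _); rewrite leq_mul2r ltuv orbT.
Qed.

Lemma invert_seq_arc (Xs : seq {set V}) u v : invert_seq D Xs u v =
  if \big[addb/false]_(X <- Xs) ((u \in X) && (v \in X)) then D v u else D u v.
Proof.
rewrite /invert_seq; elim: Xs D => [|X Xs IH] D' /=; first by rewrite big_nil.
rewrite IH big_cons /= /invert_arc andbC.
by case: ifP; case: (_ && _).
Qed.

End Acyclic.

(** Reflecting the interval realises the change of form made by [bform_reduce1]. *)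
Lemma reverse_interval p q : p < q ->
  exists h : nat -> nat, forall a b, a != b -> a != p -> a != q -> b != p -> b != q ->
    (h a < h b) = (a < b) (+) ((p < a < q) && (p < b < q)).
Proof.
move=> ltpq; exists (fun a => if p < a < q then p + q - a else a) => a b /=.
by do 2!case: ifP; lia.
Qed.

(* The blocks ]p, s[, ]s, q[, ]q, r[ are placed in the opposite order. *)
Lemma exchange_intervals p s q r : p < s -> s <= q -> q < r ->
  exists h : nat -> nat, forall a b, a != b -> a \notin [:: p; s; q; r] ->
    b \notin [:: p; s; q; r] ->
    (h a < h b) = (a < b) (+) ((p < a < q) && (s < b < r)) (+) ((s < a < r) && (p < b < q)).
Proof.
move=> lt_ps le_sq lt_qr.
exists (fun a => if a <= p then a else if a < s then a + (r - s) else
  if a < q then a + (p + r) - (q + s) else if a < r then a - (q - p) else a).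
move=> a b neq_ab; rewrite !inE !negb_or => /and4P[ap as_ aq ar] /and4P[bp bs bq br].
by do !case: ifP; lia.
Qed.

(** * Lower bound: forms aligned with an order, and their reductions *)

Section LowerBound.
Variables (k : nat) (V : 'I_k -> finType) (D : forall i : 'I_k, ograph (V i)).
Local Notation vtx := {i : 'I_k & V i}.
Local Notation inv i := (inversion_number (D i)).
Implicit Types (S : {set 'I_k}) (pos : vtx -> nat) (g : rel vtx) (u v w z r s t : vtx).

(* [g u v] tells whether the arc between [u] and [v] is reversed, [pos] is a
   topological order of the outcome; only the components in [S] are considered. *)
Definition aligned S pos g :=
  {in [pred u | tag u \in S] &, injective pos} /\
  forall u v, tag u \in S -> tag v \in S -> kjoin D u v -> g u v = (pos v < pos u).

Lemma kjoin_Tagged i (y y' : V i) : kjoin D (Tagged V y) (Tagged V y') = D i y y'.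
Proof. by rewrite /= /join_arc eqxx tagged_asE. Qed.

Lemma aligned_arc_neq S pos g u v : aligned S pos g -> tag u \in S -> tag v \in S ->
  kjoin D u v -> pos u != pos v.
Proof.
move=> [inj_pos _] uS vS; apply: contraTneq => /inj_pos -> //.
by rewrite (arc_irr (kjoin D)).
Qed.

Lemma aligned_sub S S' pos g g' : S' \subset S -> aligned S pos g ->
  (forall u v, tag u \in S' -> tag v \in S' -> g' u v = g u v) -> aligned S' pos g'.
Proof.
move=> /subsetP sS [inj_pos gE] g'E; split=> [u v /= /sS uS /sS vS|u v uS vS uv].
  exact: inj_pos.
by rewrite g'E // gE // sS.
Qed.

(** Turns linear algebra into reordering: the form changes by the same [f] that records which
    comparisons [h] flips. *)
Lemma aligned_reorder S S' pos g g' (f : rel nat) (h : nat -> nat) :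
    S' \subset S -> aligned S pos g -> symmetric f ->
    (forall u v, tag u \in S' -> tag v \in S' -> pos u != pos v ->
       (h (pos u) < h (pos v)) = (pos u < pos v) (+) f (pos u) (pos v)) ->
    (forall u v, tag u \in S' -> tag v \in S' -> g' u v = g u v (+) f (pos u) (pos v)) ->
  aligned S' (h \o pos) g'.
Proof.
move=> /subsetP sS al fC hE g'E; have [inj_pos gE] := al.
split=> [u v uS' vS' /= eq_h|u v uS vS uv].
  apply: inj_pos; rewrite ?inE ?sS //; apply/eqP/negPn/negP => neq_uv.
  (* If [h] merged two positions, both comparisons would become false; but [f], being symmetric,
     keeps exactly one of them true. *)
  have := hE v u vS' uS'; rewrite eq_sym neq_uv => /(_ isT).
  have := hE u v uS' vS' neq_uv; rewrite eq_h ltnn fC.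
  by case: (ltngtP (pos u) (pos v)) neq_uv => //=; case: (f _ _).
have neq_uv : pos v != pos u by rewrite eq_sym (aligned_arc_neq al) ?sS.
by rewrite g'E //= hE // gE ?sS // fC.
Qed.

(** The arcs joining [z] to [u] and to [v] have the same direction in the join, so exactly one is
    reversed iff [z] separates [u] from [v] in the order. *)
Lemma aligned_btw S pos g u v z : aligned S pos g -> symmetric g ->
  tag u \in S -> tag z \in S -> tag u = tag v -> tag z != tag u ->
  pos u < pos v -> g u z (+) g v z = (pos u < pos z < pos v).
Proof.
move=> [inj_pos gE] gC uS zS uv zu ltuv; have vS : tag v \in S by rewrite -uv.
have nu : pos z != pos u.
  by apply: contraNneq zu => /inj_pos -> //.
have nv : pos z != pos v.
  by apply: contraNneq zu => /inj_pos -> //; rewrite uv.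
have arcE y y' : tag y != tag y' -> kjoin D y y' = (tag y < tag y').
  by rewrite /= /join_arc => /negPf ->.
have [lt|le] := ltnP (tag u) (tag z).
  by rewrite !gE // ?arcE -?uv // 1?eq_sym //; lia.
have lt : tag z < tag u by rewrite ltn_neqAle le andbT.
by rewrite ![g _ z]gC !gE // ?arcE -?uv //; lia.
Qed.

Variables (N : nat) (x : vtx -> 'rV['F_2]_N).
Implicit Types (B : 'M['F_2]_N).
Definition gram B : rel vtx := fun u v => bform B (x u) (x v).

Lemma gramC B : (B^T)%R = B -> symmetric (gram B).
Proof. by move=> sB u v; apply: bformC. Qed.

Lemma gram_diff B u v : (B^T)%R = B ->
  bform B (x u + x v)%R (x u + x v)%R = gram B u u (+) gram B v v.
Proof.
by move=> /gramC gC; rewrite !bformDl !bformDr -!/(gram _ _ _) (gC v u); do 3!case: gram.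
Qed.

(** The vectors [x] stay fixed; the order and the form are quantified because the reductions change
    both. *)
Definition bounded S := forall pos B, (B^T)%R = B -> aligned S pos (gram B) ->
  \sum_(i in S) inv i <= \rank B.

(** Here [x u + x v] is anisotropic. Projecting it away lowers the rank and, by [aligned_btw],
    reverses the interval between [u] and [v]. *)
Lemma bounded_anisotropic S pos B u v : (B^T)%R = B -> aligned S pos (gram B) ->
  tag u \in S -> tag u = tag v -> inv (tag u) = 1 -> bounded (S :\ tag u) ->
  gram B u u != gram B v v -> \sum_(i in S) inv i <= \rank B.
Proof.
move=> sB al uS uv inv1 bnd.
wlog ltuv : u v uS uv inv1 bnd / pos u < pos v => [IH ne|ne].
  case: (ltngtP (pos u) (pos v)) => [lt|lt|/al.1 eq_uv]; first exact: (IH u v).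
    by apply: (IH v u) => //; rewrite -?uv // eq_sym.
  by rewrite eq_uv ?eqxx // inE -?uv // in ne.
have gC := gramC sB.
have [|B' [sB' ltB' B'E]] := @bform_reduce1 _ B (x u + x v)%R sB.
  by rewrite gram_diff //; move: ne; do 2!case: gram.
have [h hE] := reverse_interval ltuv.
rewrite (big_setD1 _ uS) /= inv1 add1n; apply: leq_trans ltB'.
rewrite ltnS; apply: bnd sB' _.
have act w : tag w \in S :\ tag u -> (tag w \in S) * (pos w != pos u) * (pos w != pos v).
  rewrite !inE => /andP[wu wS]; split; first split => //.
    by apply: contraNneq wu => /(al.1) -> //.
  by apply: contraNneq wu => /(al.1) -> //; rewrite ?inE -?uv.
have btE w : tag w \in S :\ tag u ->
    gram B u w (+) gram B v w = (pos u < pos w < pos v).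
  by rewrite !inE => /andP[wu wS]; apply: aligned_btw al _ _ _ _ _ _.
apply: (aligned_reorder (h := h) (f := fun a b =>
  (pos u < a < pos v) && (pos u < b < pos v)) _ al).
- exact: subsetDl.
- by move=> a b; rewrite andbC.
- by move=> w z /act wP /act zP ne'; rewrite hE ?wP ?zP.
move=> w z wS zS; rewrite /gram B'E !bformDl -!/(gram _ _ _).
rewrite (btE w wS) (btE z zS); exact: erefl.
Qed.

Lemma pos_neq S pos g u w : aligned S pos g -> tag u \in S -> tag w \in S -> tag w != tag u ->
  pos w != pos u.
Proof. by move=> [inj_pos _] uS wS; apply: contraNneq => /inj_pos ->. Qed.

(** Since [s] but not [r] lies between [p] and [q], the isotropic vectors [x p + x q] and
    [x s + x r] form a hyperbolic pair. Removing it lowers the rank by at least 2, the contribution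
    of the two components, and exchanges intervals. *)
Lemma bounded_cross S pos B p q s r : (B^T)%R = B -> aligned S pos (gram B) ->
  tag p \in S -> tag s \in S -> tag p = tag q -> tag s = tag r -> tag p != tag s ->
  inv (tag p) = 1 -> inv (tag s) = 1 -> bounded (S :\ tag p :\ tag s) ->
  gram B p p = gram B q q -> gram B s s = gram B r r ->
  pos p < pos s -> pos s < pos q -> pos q < pos r -> \sum_(i in S) inv i <= \rank B.
Proof.
move=> sB al pS sS pq sr ps invp invs bnd isop isos lt_ps lt_sq lt_qr.
have gC := gramC sB.
have qS : tag q \in S by rewrite -pq.
have btP w : tag w \in S -> tag w != tag p ->
    gram B p w (+) gram B q w = (pos p < pos w < pos q).
  by move=> wS wp; apply: aligned_btw al _ _ _ _ _ _ => //; apply: ltn_trans lt_sq.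
have btS w : tag w \in S -> tag w != tag s ->
    gram B s w (+) gram B r w = (pos s < pos w < pos r).
  by move=> wS ws; apply: aligned_btw al _ _ _ _ _ _ => //; apply: ltn_trans lt_qr.
have dd : ~~ bform B (x p + x q)%R (x p + x q)%R.
  by rewrite gram_diff // isop addbb.
have ee : bform B (x s + x r)%R (x s + x r)%R = false.
  by rewrite gram_diff // isos addbb.
have [|B' [sB' leB' B'E]] := @bform_reduce2 _ B (x p + x q)%R (x s + x r)%R sB dd.
  have rS : tag r \in S by rewrite -sr.
  have rp : tag r != tag p by rewrite -sr eq_sym.
  rewrite bformDr !bformDl -!/(gram _ _ _) (btP s sS) 1?eq_sym //.
  by rewrite (btP r rS rp) lt_ps lt_sq (leq_gtF (ltnW lt_qr)) andbF.
have [h hE] := exchange_intervals lt_ps (ltnW lt_sq) lt_qr.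
have sSp : tag s \in S :\ tag p by rewrite !inE sS eq_sym ps.
rewrite (big_setD1 _ pS) (big_setD1 _ sSp) /= invp invs addnA addnC.
apply: leq_trans leB'; rewrite leq_add2r; apply: bnd sB' _.
have act w : tag w \in S :\ tag p :\ tag s ->
    [/\ tag w \in S, tag w != tag p, tag w != tag s &
    pos w \notin [:: pos p; pos s; pos q; pos r]].
  rewrite !inE => /and3P[ws wp wS]; split=> //; rewrite !negb_or.
  by rewrite !(pos_neq al) -?pq -?sr.
apply: (aligned_reorder (h := h) (f := fun a b =>
  (pos p < a < pos q) && (pos s < b < pos r) (+)
  (pos s < a < pos r) && (pos p < b < pos q)) _ al).
- exact: subset_trans (subsetDl _ _) (subsetDl _ _).
- by move=> a b; rewrite addbC; congr (_ (+) _); apply: andbC.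
- by move=> w z /act[_ _ _ wP] /act[_ _ _ zP] ne; rewrite hE // addbA.
move=> w z /act[wS wp ws _] /act[zS zp zs _].
rewrite /gram B'E ee addbF !bformDl -!/(gram _ _ _) addbA.
rewrite (btP w wS wp) (btP z zS zp) (btS w wS ws) (btS z zS zs).
exact: erefl.
Qed.

(** The last hypothesis says that the isotropic vectors [x r + x s] and [x s + x t] form a
    hyperbolic pair. Removing it exchanges two adjacent intervals, the middle block being empty. *)
Lemma bounded_exchange S pos B r s t : (B^T)%R = B -> aligned S pos (gram B) ->
  tag r \in S -> tag r = tag s -> tag r = tag t -> inv (tag r) = 1 ->
  bounded (S :\ tag r) -> gram B r r = gram B s s -> gram B t t = gram B s s ->
  pos r < pos s -> pos s < pos t ->
  gram B r s (+) gram B s t (+) gram B r t (+) gram B s s -> \sum_(i in S) inv i <= \rank B.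
Proof.
move=> sB al rS rs rt invr bnd isor isot lt_rs lt_st c1.
have gC := gramC sB.
have btR w : tag w \in S -> tag w != tag r ->
    gram B r w (+) gram B s w = (pos r < pos w < pos s).
  by move=> wS wr; apply: aligned_btw al _ _ _ _ _ _.
have btS w : tag w \in S -> tag w != tag r ->
    gram B s w (+) gram B t w = (pos s < pos w < pos t).
  by move=> wS wr; apply: aligned_btw al _ _ _ _ _ _ => //; rewrite -?rs.
have dd : ~~ bform B (x r + x s)%R (x r + x s)%R.
  by rewrite gram_diff // isor addbb.
have ee : bform B (x s + x t)%R (x s + x t)%R = false.
  by rewrite gram_diff // isot addbb.
have [|B' [sB' leB' B'E]] := @bform_reduce2 _ B (x r + x s)%R (x s + x t)%R sB dd.
  by rewrite bformDr !bformDl -!/(gram _ _ _); move: c1; do 4!case: gram.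
have [h hE] := exchange_intervals lt_rs (leqnn _) lt_st.
rewrite (big_setD1 _ rS) /= invr addnC; apply: leq_trans leB'.
apply: leq_add => //; apply: bnd sB' _.
have act w : tag w \in S :\ tag r -> [/\ tag w \in S, tag w != tag r &
    pos w \notin [:: pos r; pos s; pos s; pos t]].
  rewrite !inE => /andP[wr wS]; split=> //; rewrite !negb_or.
  by rewrite !(pos_neq al) -?rs -?rt.
apply: (aligned_reorder (h := h) (f := fun a b =>
  (pos r < a < pos s) && (pos s < b < pos t) (+)
  (pos s < a < pos t) && (pos r < b < pos s)) _ al).
- exact: subsetDl.
- by move=> a b; rewrite addbC; congr (_ (+) _); apply: andbC.
- by move=> w z /act[_ _ wP] /act[_ _ zP] ne; rewrite hE // addbA.
move=> w z /act[wS wr _] /act[zS zr _].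
rewrite /gram B'E ee addbF !bformDl -!/(gram _ _ _) addbA.
rewrite (btR w wS wr) (btR z zS zr) (btS w wS wr) (btS z zS zr).
exact: erefl.
Qed.

(* [x u + x v] is isotropic and orthogonal to the other components, so projecting
   to the complement of the hyperbolic pair it forms with [x w] does not change
   the form on them. *)
Lemma bounded_twins S pos B u v w : (B^T)%R = B -> aligned S pos (gram B) ->
  tag u \in S -> tag u = tag v -> inv (tag u) = 1 -> bounded (S :\ tag u) ->
  gram B u u = gram B v v -> pos u < pos v ->
  (forall z, tag z \in S -> tag z != tag u -> ~~ (pos u < pos z < pos v)) ->
  gram B u w != gram B v w -> \sum_(i in S) inv i <= \rank B.
Proof.
move=> sB al uS uv inv1 bnd isou ltuv gap ne.
have gC := gramC sB.
have dd : ~~ bform B (x u + x v)%R (x u + x v)%R.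
  by rewrite gram_diff // isou addbb.
have [|B' [sB' leB' B'E]] := @bform_reduce2 _ B (x u + x v)%R (x w) sB dd.
  by rewrite bformDl -!/(gram _ _ _); move: ne; do 2!case: gram.
rewrite (big_setD1 _ uS) /= inv1 addnC; apply: leq_trans leB'.
apply: leq_add => //; apply: bnd sB' _.
apply: (aligned_sub _ al); first exact: subsetDl.
have orth y : tag y \in S :\ tag u -> bform B (x u + x v)%R (x y) = false.
  rewrite !inE => /andP[yu yS]; rewrite bformDl -!/(gram _ _ _).
  by rewrite (aligned_btw al gC uS yS uv yu ltuv); apply/negbTE/gap.
by move=> y z yS zS; rewrite /gram B'E (orth y yS) (orth z zS) !andbF !addbF.
Qed.

(* [x r + x s] and [x s + x t] span a totally isotropic plane, and [x y], [x z]
   complete them to hyperbolic pairs: the rank drops by 4, the sum by at most 3. *)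
Lemma bounded_plane S pos B r s t y z : (B^T)%R = B -> aligned S pos (gram B) ->
  tag r \in S -> tag r = tag s -> tag r = tag t -> inv (tag r) = 1 ->
  tag y \in S -> tag y = tag z -> tag y != tag r -> inv (tag y) <= 2 ->
  bounded (S :\ tag r :\ tag y) -> gram B r r = gram B s s -> gram B t t = gram B s s ->
  ~~ (gram B r s (+) gram B s t (+) gram B r t (+) gram B s s) ->
  pos r < pos y < pos s -> pos s < pos z < pos t ->
  (forall w, tag w \in S -> tag w != tag r -> tag w != tag y -> ~~ (pos r < pos w < pos t)) ->
  \sum_(i in S) inv i <= \rank B.
Proof.
move=> sB al rS rs rt invr yS yz yr invy bnd isor isot c0 ry_s sz_t gap.
have gC := gramC sB.
have [lt_rs lt_st] : pos r < pos s /\ pos s < pos t by move: ry_s sz_t; clear; lia.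
have btR w : tag w \in S -> tag w != tag r ->
    bform B (x r + x s)%R (x w) = (pos r < pos w < pos s).
  by move=> wS wr; rewrite bformDl; apply: (aligned_btw al gC).
have btS w : tag w \in S -> tag w != tag r ->
    bform B (x s + x t)%R (x w) = (pos s < pos w < pos t).
  by move=> wS wr; rewrite bformDl; apply: (aligned_btw al gC) => //; rewrite -?rs.
have dd : ~~ bform B (x r + x s)%R (x r + x s)%R.
  by rewrite gram_diff // isor addbb.
have ee : bform B (x s + x t)%R (x s + x t)%R = false.
  by rewrite gram_diff // isot addbb.
have de : bform B (x r + x s)%R (x s + x t)%R = false.
  by rewrite bformDr !bformDl -!/(gram _ _ _); move: c0; do 4!case: gram.
have [zS zr] : tag z \in S /\ tag z != tag r by rewrite -yz.
have [|B1 [sB1 leB1 B1E]] := bform_reduce2 sB dd (e := x y).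
  by rewrite btR.
have ye : bform B (x y) (x s + x t)%R = false.
  by rewrite bformC // btS //; move: ry_s; clear; lia.
(* The second vector is orthogonal to the first hyperbolic pair, so the first projection preserves
   its products. *)
have B1e (w : 'rV_N) : bform B1 (x s + x t)%R w = bform B (x s + x t)%R w.
  by rewrite B1E de (bformC (x y)) // (bformC _ (x y)) // ye !andbF /= !addbF.
have [||B2 [sB2 leB2 B2E]] := @bform_reduce2 _ B1 (x s + x t)%R (x z) sB1.
- by rewrite B1e ee.
- by rewrite B1e btS.
have ySr : tag y \in S :\ tag r by rewrite !inE yS yr.
have leB : \rank B2 + 3 <= \rank B by move: leB1 leB2; clear; lia.
rewrite (big_setD1 _ rS) (big_setD1 _ ySr) /= invr addnA addnC.
apply: leq_trans leB; apply: leq_add; last by rewrite add1n ltnS.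
apply: bnd sB2 _; apply: (aligned_sub _ al).
  exact: subset_trans (subsetDl _ _) (subsetDl _ _).
have orth w : tag w \in S :\ tag r :\ tag y ->
    bform B (x r + x s)%R (x w) = false /\ bform B (x s + x t)%R (x w) = false.
  rewrite !inE => /and3P[wy wr wS]; have := gap w wS wr wy.
  by rewrite btR // btS //; move: lt_rs lt_st; clear; lia.
move=> w w' /orth[w1 w2] /orth[w1' w2'].
by rewrite /gram B2E !B1e w2 w2' B1E w1 w1' !andbF !addbF.
Qed.

(** By [twin] and [iso] the form has one value inside both classes of [Q] and one between them.
    Undoing the reversals thus amounts to reversing both classes or swapping them as blocks, or
    both, which leaves a linear order. *)
Lemma acyclic_two_gaps S pos g (i : 'I_k) (Q : pred vtx) u0 :
  aligned S pos g -> symmetric g -> i \in S ->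
  (forall v, tag v = i -> g v v = g u0 u0) -> tag u0 = i -> ~~ Q u0 ->
  (forall u v w, tag u = i -> tag v = i -> Q u = Q v -> g u w = g v w) ->
  (forall u v, tag u = i -> tag v = i -> ~~ Q u -> Q v -> pos u < pos v) ->
  acyclic (D i).
Proof.
move=> al gC iS iso u0i /negbTE Q0 twin ltPQ.
have [M posM] : exists M, forall v, pos v < M.
  by exists (\max_v pos v).+1 => v; rewrite ltnS (leq_bigmax v).
have gP v : tag v = i -> ~~ Q v -> g u0 v = g u0 u0.
  by move=> vi /negbTE Qv; rewrite gC; apply: twin; rewrite ?Q0.
(* The second summand orders each class; the offset [M], exceeding all positions, places the
   classes. Outside [Q], [g u0 v] equals [g u0 u0]. *)
pose f v := (if g u0 v then 0 else M) + (if g u0 u0 then M - pos v else pos v).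
apply: (@acyclic_of_pos _ _ (fun y => f (Tagged V y))) => y y' yy'.
move: yy'; rewrite -kjoin_Tagged => yy'.
have tS (z : V i) : tag (Tagged V z) \in S := iS.
have ne := aligned_arc_neq al (tS y) (tS y') yy'.
have := al.2 _ _ (tS y) (tS y') yy'.
move: (Tagged V y) (Tagged V y') (erefl : tag (Tagged V y) = i)
  (erefl : tag (Tagged V y') = i) ne {yy'}.
move=> {y y'} v v' vi v'i ne gvv'.
have := posM v; have := posM v'; rewrite /f.
have same : Q v = Q v' -> g v v' = g u0 u0 /\ g u0 v = g u0 v'.
  move=> eqQ; rewrite (twin v v') // iso //; split=> //.
  by rewrite !(gC u0); apply: twin.
have gPQ w w' : tag w = i -> tag w' = i -> ~~ Q w -> Q w' ->
    [/\ g w w' = g u0 w', g u0 w = g u0 u0 & pos w < pos w'].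
  move=> wi w'i Qw Qw'; split; [|exact: gP|exact: ltPQ].
  by apply: twin; rewrite ?Q0 ?(negbTE Qw).
case Qv : (Q v); case Qv' : (Q v').
- have [|e1 e2] := same; rewrite ?Qv //.
  move: ne gvv'; rewrite e1 e2; move: (g u0 u0) (g u0 v') (pos v) (pos v'); clear.
  by do 2!case; lia.
- have [||||e1 e2 lt] := gPQ v' v; rewrite ?Qv' //.
  move: ne gvv' lt; rewrite gC e1 e2; move: (g u0 u0) (g u0 v) (pos v) (pos v'); clear.
  by do 2!case; lia.
- have [||||e1 e2 lt] := gPQ v v'; rewrite ?Qv //.
  move: ne gvv' lt; rewrite e1 e2; move: (g u0 u0) (g u0 v') (pos v) (pos v'); clear.
  by do 2!case; lia.
- have [|e1 e2] := same; rewrite ?Qv //.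
  move: ne gvv'; rewrite e1 e2; move: (g u0 u0) (g u0 v') (pos v) (pos v'); clear.
  by do 2!case; lia.
Qed.

(** On the component, a symmetric form of rank at most 1 is the product of an indicator with itself,
    so inverting one set would suffice. *)
Lemma rank_gt1 S pos B i : (B^T)%R = B -> aligned S pos (gram B) -> i \in S ->
  1 < inv i -> 1 < \rank B.
Proof.
move=> sB al iS inv2; have gE := al.2.
have tS (y : V i) : tag (Tagged V y) \in S := iS.
rewrite ltnNge; apply/negP=> leB1.
suff [X gX] : exists X : {set V i}, forall y y',
    gram B (Tagged V y) (Tagged V y') = (y \in X) && (y' \in X).
  have : decycling (D i) [:: X].
    apply: (@acyclic_of_pos _ _ (fun y => pos (Tagged V y))) => y y'.
    rewrite invert_seq_arc big_seq1 -gX; set b := gram B _ _.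
    case: ifP => bE; rewrite -kjoin_Tagged => yy'.
      by have := gE _ _ (tS _) (tS _) yy'; rewrite gramC // -/b bE.
    rewrite ltn_neqAle leqNgt (aligned_arc_neq al (tS _) (tS _) yy').
    by have := gE _ _ (tS _) (tS _) yy'; rewrite -/b bE => <-.
  by move/inversion_number_min; rewrite leqNgt inv2.
have [/existsP[u uu]|no_u] := boolP [exists u : V i, gram B (Tagged V u) (Tagged V u)].
  have [B' [_ ltB' B'E]] := bform_reduce1 sB uu.
  (* Projecting [x u] away kills the form, which is therefore the square of the functional given by
     [x u]. *)
  have B'0 : B' = 0%R by apply/eqP; rewrite -mxrank_eq0 -leqn0 -ltnS (leq_trans ltB').
  exists [set y | gram B (Tagged V u) (Tagged V y)] => y y'; rewrite !inE.
  have := B'E (x (Tagged V y)) (x (Tagged V y')).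
  by rewrite B'0 bform0 /gram; do 3!case: bform.
(* With all vectors of the component isotropic, a nonzero product would give a hyperbolic pair and
   rank at least 2. *)
exists set0 => y y'; rewrite !inE; apply/negbTE/negP => gyy'.
have no_y : ~~ gram B (Tagged V y) (Tagged V y).
  by apply: contra no_u => ?; apply/existsP; exists y.
have [B' [_ leB' _]] := bform_reduce2 sB no_y gyy'.
by have := leq_trans leB' leB1; rewrite addn2.
Qed.

(** * The induction on the set of components *)

Lemma bounded_all : (forall i, inv i <= 2) ->
  (forall i j, inv i = 2 -> inv j = 2 -> i = j) -> forall S, bounded S.
Proof.
move=> le2 eq2 S; have [n] := ubnP #|S|; elim: n S => // n IH S ltSn pos B sB al.
have IHD i : i \in S -> bounded (S :\ i).
  by move=> iS; apply: IH; rewrite (cardsD1 i S) iS in ltSn.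
have IHD2 i j : i \in S -> bounded (S :\ i :\ j).
  move=> iS; apply: IH; rewrite (cardsD1 i S) iS in ltSn.
  apply: leq_ltn_trans (ltSn : #|S :\ i| < n).
  exact/subset_leq_card/subsetDl.
have [/exists_inP[i iS /eqP inv0]|no0] := boolP [exists i in S, inv i == 0].
  rewrite (big_setD1 _ iS) /= inv0 add0n; apply: (IHD i iS pos B sB).
  by apply: (aligned_sub _ al) => //; apply: subsetDl.
have inv12 i : i \in S -> inv i != 1 -> inv i = 2.
  move=> iS; have := le2 i.
  have : inv i != 0 by apply: contra no0 => ?; apply/exists_inP; exists i.
  by case: (inv i) => [|[|[|]]].
have [/exists_inP[i0 iS0 inv0]|no1] := boolP [exists i in S, inv i == 1]; last first.
  have inv2 i : i \in S -> inv i = 2.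
    by move=> iS; apply: inv12 => //; apply: contra no1 => ?; apply/exists_inP; exists i.
  (* All inversion numbers are now 2, so [S] has at most one element. *)
  have [->|[i iS]] := set_0Vmem S; first by rewrite big_set0.
  have -> : S = [set i].
    apply/setP=> j; rewrite !inE; apply/idP/eqP => [jS|-> //].
    by apply: eq2; apply: inv2.
  by rewrite big_set1 inv2 //; apply: (rank_gt1 sB al iS); rewrite inv2.
(* From here on the bound is assumed to fail, so each reduction that would prove it yields a
   structural constraint. *)
rewrite leqNgt; apply/negP=> ltB.
have gC := gramC sB.
have absurd : \sum_(i in S) inv i <= \rank B -> False by rewrite leqNgt ltB.
pose S1 i := (i \in S) && (inv i == 1).
have iso u v : S1 (tag u) -> tag u = tag v -> gram B u u = gram B v v.
  move=> /andP[uS /eqP inv1] uv.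
  have [//|ne] := eqVneq (gram B u u) (gram B v v); case: absurd.
  exact: (bounded_anisotropic sB al uS uv inv1 (IHD _ uS) ne).
(* Components of inversion number 1 do not interleave: one that meets an interval between two
   vertices of another lies inside it. *)
have cross u v z w : S1 (tag u) -> S1 (tag z) -> tag u = tag v -> tag z = tag w ->
    tag z != tag u -> pos u < pos z < pos v -> pos u < pos w < pos v.
  move=> uS1 zS1 uv zw zu uzv; apply/negPn/negP => nuwv; apply: absurd.
  have [[uS /eqP inv1] [zS /eqP invz]] := (andP uS1, andP zS1).
  have vS : tag v \in S by rewrite -uv.
  have wS : tag w \in S by rewrite -zw.
  have wu : pos w != pos u by apply: (pos_neq al); rewrite // -zw.
  have wv : pos w != pos v by apply: (pos_neq al); rewrite // -zw -uv.
  have [lt|le] := ltnP (pos w) (pos u).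
    apply: (@bounded_cross S pos B w z u v) => //; rewrite -?zw //; try by apply: IHD2.
    - by rewrite (iso z w).
    - exact: iso.
    - by case/andP: uzv.
    - by case/andP: uzv.
  apply: (@bounded_cross S pos B u v z w) => //; rewrite 1?eq_sym //; try by apply: IHD2.
  - exact: iso.
  - exact: iso.
  - by case/andP: uzv.
  - by case/andP: uzv.
  - by move: wu wv nuwv le uzv; clear; lia.
pose hull i := [set z : vtx | [exists u : vtx, [exists v : vtx,
  [&& tag u == i, tag v == i, pos u <= pos z & pos z <= pos v]]]].
have S1i0 : S1 i0 by apply/andP.
(* By minimality of the hull no other component of inversion number 1 meets the span of [D i]: by
   [cross] its hull would be strictly smaller, missing [u]. *)
case: (arg_minnP (fun i => #|hull i|) S1i0) => i S1i min_i.
have [iS /eqP inv1] := andP S1i.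
have nocross u v z : tag u = i -> tag v = i -> S1 (tag z) -> tag z != i ->
    ~~ (pos u < pos z < pos v).
  move=> ui vi S1z zi; apply/negP => uzv.
  have {}cross w : tag w = tag z -> pos u < pos w < pos v.
    by move=> wz; apply: (cross u v z w); rewrite ?ui ?vi.
  have := min_i _ S1z; rewrite leqNgt => /negP[]; apply/proper_card/properP; split.
    apply/subsetP=> y; rewrite !inE.
    case/existsP=> w /existsP[w' /and4P[/eqP/cross uwv /eqP/cross uwv' wy yw']].
    apply/existsP; exists u; apply/existsP; exists v; rewrite ui vi eqxx /=.
    by move: uwv uwv' wy yw'; clear; lia.
  exists u; rewrite inE.
    apply/existsP; exists u; apply/existsP; exists v; rewrite ui vi eqxx leqnn /=.
    by move: uzv; clear; lia.
  apply/negP=> /existsP[w /existsP[w' /and4P[/eqP/cross uwv _ wu _]]].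
  by move: uwv wu; clear; lia.
pose sep u v := [exists z : vtx, [&& tag z \in S, tag z != i & pos u < pos z < pos v]].
have twins u v w : tag u = i -> tag v = i -> pos u < pos v -> ~~ sep u v ->
    gram B u w = gram B v w.
  move=> ui vi ltuv nsep; have [//|ne] := eqVneq (gram B u w) (gram B v w); case: absurd.
  apply: (@bounded_twins S pos B u v w); rewrite ?ui ?vi //.
  - exact: IHD.
  - by apply: iso; rewrite ui ?vi.
  - by move=> z zS zi; apply: contra nsep => uzv; apply/existsP; exists z; rewrite zS zi.
(* The separating vertices lie in the unique component of inversion number 2; the product of the two
   differences decides between [bounded_exchange] and [bounded_plane]. *)
have no3 r s t : tag r = i -> tag s = i -> tag t = i -> sep r s -> sep s t -> False.
  move=> ri si ti /existsP[y /and3P[yS yi rys]] /existsP[z /and3P[zS zi szt]].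
  have inv_y w : tag w \in S -> tag w != i -> pos r < pos w < pos t -> inv (tag w) = 2.
    move=> wS wi rwt; apply: inv12 => //; apply: contraL rwt => w1.
    by apply: nocross => //; apply/andP.
  have [lt_rs lt_st] : pos r < pos s /\ pos s < pos t by move: rys szt; clear; lia.
  have yz : tag y = tag z.
    by apply: eq2; apply: inv_y => //; move: rys szt; clear; lia.
  apply: absurd.
  case c : (gram B r s (+) gram B s t (+) gram B r t (+) gram B s s).
    apply: (@bounded_exchange S pos B r s t); rewrite ?ri ?si ?ti //.
    - exact: IHD.
    - by apply: iso; rewrite ri ?si.
    - by apply: iso; rewrite ti ?si.
  apply: (@bounded_plane S pos B r s t y z); rewrite ?ri ?si ?ti ?c //.
  - exact: IHD2.
  - by apply: iso; rewrite ri ?si.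
  - by apply: iso; rewrite ti ?si.
  - move=> w wS wi wy; apply/negP=> rwt; case/eqP: wy; apply: eq2; apply: inv_y => //.
    by move: rys szt; clear; lia.
suff acD : acyclic (D i).
  by have := @inversion_number_min _ (D i) [::] acD; rewrite inv1.
have [y0 _|V0] := pickP (V i); last first.
  by apply: (@acyclic_of_pos _ _ (fun=> 0)) => y; have := V0 y.
(* The first vertex [u0] of [D i] defines the two classes: [sep u0] holds for the vertices separated
   from it. *)
case: (@arg_minnP _ y0 xpredT (fun y => pos (Tagged V y))) => // {}y0 _ min0.
set u0 := Tagged V y0 in min0.
have {}min0 v : tag v = i -> pos u0 <= pos v.
  by case: v => j y /= ji; subst j; apply: min0.
have sepW u v w : pos u0 <= pos u -> sep u v -> pos v <= pos w -> sep u0 w.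
  move=> le_u /existsP[z /and3P[zS zi uzv]] le_w; apply/existsP; exists z.
  by rewrite zS zi /=; move: le_u uzv le_w; clear; lia.
apply: (@acyclic_two_gaps S pos (gram B) i (sep u0) u0) => //.
- by move=> v vi; apply: iso; rewrite vi.
- by apply/existsP=> -[z /and3P[_ _]]; clear; lia.
(* A separation inside a class would put [v], hence also [u], in [sep u0], and then [u0], [u], [v]
   contradict [no3]. *)
- have lem u v w : tag u = i -> tag v = i -> sep u0 u = sep u0 v -> pos u < pos v ->
      gram B u w = gram B v w.
    move=> ui vi eqQ ltuv; apply: twins => //; apply/negP => sep_uv.
    have Qv : sep u0 v by apply: sepW sep_uv _; rewrite ?min0.
    by apply: (no3 u0 u v); rewrite ?eqQ.
  move=> u v w ui vi eqQ.
  have [lt|lt|/al.1 ->] := ltngtP (pos u) (pos v); rewrite ?inE ?ui ?vi //.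
    exact: lem.
  by apply/esym/lem.
- move=> u v ui vi Qu Qv; rewrite ltnNge; apply: contra Qu => le_vu.
  exact: sepW Qv le_vu.
Qed.

End LowerBound.

(** * Upper bound: combining decycling families of the components *)

Section UpperBound.
Variables (k : nat) (V : 'I_k -> finType) (D : forall i : 'I_k, ograph (V i)).

Lemma kjoin_decycling_size (Xs : forall i, seq {set V i}) :
  (forall i, decycling (D i) (Xs i)) ->
  inversion_number (kjoin D) <= \sum_(i < k) size (Xs i).
Proof.
move=> acD.
pose lift i (X : {set V i}) := [set Tagged V y | y in X].
pose Ys := [seq lift i X | i <- enum 'I_k, X <- Xs i].
have -> : \sum_(i < k) size (Xs i) = size Ys.
  by rewrite size_allpairs_dep sumnE big_map big_enum.
apply: inversion_number_min.
have [pos _ posE] := fin_all_exists2 (fun i => pos_of_acyclic (acD i)).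
have [M posM] : exists M, forall v : {i : 'I_k & V i}, pos (tag v) (tagged v) < M.
  exists (\max_(v : {i : 'I_k & V i}) pos (tag v) (tagged v)).+1 => v.
  by rewrite ltnS (leq_bigmax v).
have mem_lift i (X : {set V i}) y : (Tagged V y \in lift i X) = (y \in X).
  apply: mem_imset => {}y y' /eqP.
  by rewrite -tag_eqE /tag_eq eqxx tagged_asE => /eqP.
have mem_lift0 i (X : {set V i}) v : tag v != i -> (v \in lift i X) = false.
  by apply: contraNF => /imsetP[y _ ->].
rewrite /decycling.
(* The order is lexicographic: first the component index, then the position inside the component,
   which is below [M]. *)
apply: (@acyclic_of_pos _ (invert_seq (kjoin D) Ys)
  (fun v => tag v * M + pos (tag v) (tagged v))) => u v.
rewrite invert_seq_arc big_allpairs_dep big_enum /=.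
have [uv|neq] := eqVneq (tag u) (tag v); last first.
  rewrite big1 => [|i _]; last first.
    rewrite big1 // => X _; have [ui|nui] := eqVneq (tag u) i; last by rewrite mem_lift0.
    by rewrite andbC mem_lift0 // -ui eq_sym.
  rewrite /= /join_arc (negbTE neq) => lt_uv.
  apply: (@leq_trans ((tag u).+1 * M)); first by rewrite mulSn addnC ltn_add2r.
  by apply: leq_trans (leq_addr _ _); rewrite leq_mul2r lt_uv orbT.
case: u v uv => i y [j y'] /= ij; subst j.
rewrite ltn_add2l (bigD1 i) //= [X in _ (+) X]big1 ?addbF => [|j ji]; last first.
  by rewrite big1 // => X _; rewrite mem_lift0 //= eq_sym.
rewrite /join_arc /= eqxx !tagged_asE => yy'; apply: posE; rewrite invert_seq_arc.
by under eq_bigr do rewrite -[y \in _]mem_lift -[y' \in _]mem_lift.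
Qed.

End UpperBound.

(** * The form attached to a decycling family *)

Section GramOfFamily.
Import GRing.Theory.
Local Open Scope ring_scope.

(** Over F_2 the dot product counts common sets modulo 2, the parity that decides in
    [invert_seq_arc] whether an arc is reversed. *)
Lemma bform_incidence (V : finType) (Xs : seq {set V}) (u v : V) :
  let x w : 'rV['F_2]_(size Xs) := \row_j (w \in nth set0 Xs j)%:R in
  bform 1%:M (x u) (x v) = \big[addb/false]_(X <- Xs) ((u \in X) && (v \in X)).
Proof.
have neq00 : ((0 : 'F_2) != 0) = false by rewrite eqxx.
rewrite /= bformE mulmx1 mxE (big_morph (fun a : 'F_2 => a != 0) F2_neq0D neq00).
rewrite (big_nth set0) big_mkord; apply: eq_bigr => j _; rewrite !mxE.
by case: (u \in _); case: (v \in _).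
Qed.

End GramOfFamily.

Theorem theorem1p4 (k : nat) (V : 'I_k -> finType)
    (D : forall i : 'I_k, ograph (V i))
    (inv_le2 : forall i : 'I_k, inversion_number (D i) <= 2)
    (inv_eq2 : #|[set i : 'I_k | inversion_number (D i) == 2]| <= 1) :
  inversion_number (kjoin D) = \sum_(i < k) inversion_number (D i).
Proof.
apply/eqP; rewrite eqn_leq; apply/andP; split.
  have [Xs sXs acD] := fin_all_exists2 (fun i => inversion_number_decycling (D i)).
  have := kjoin_decycling_size acD; congr (_ <= _).
  by apply: eq_bigr => i _; apply: sXs.
have [Xs <- acX] := inversion_number_decycling (kjoin D).
have [pos inj_pos posE] := pos_of_acyclic acX.
pose x w := (\row_(j < size Xs) (w \in nth set0 Xs j)%:R)%R : 'rV['F_2]_(size Xs).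
have -> : \sum_(i < k) inversion_number (D i) =
    \sum_(i in [set: 'I_k]) inversion_number (D i).
  by apply: eq_bigl => i; rewrite inE.
(* The size of the family is the rank of the standard form, to which the lower bound is applied. *)
rewrite -[leqRHS](mxrank1 'F_2); apply: (bounded_all (x := x) inv_le2 _ (pos := pos)).
- move=> i j i2 j2; apply: (card_le1_eqP inv_eq2); rewrite inE ?i2 ?j2 //.
- exact: trmx1.
split=> [u v _ _|u v _ _ uv]; first exact: inj_pos.
rewrite /gram bform_incidence; set b := \big[_/_]_(_ <- _) _.
have sym_b : \big[addb/false]_(X <- Xs) ((v \in X) && (u \in X)) = b.
  by apply: eq_bigr => X _; rewrite andbC.
case bE: b.
  by rewrite posE // invert_seq_arc sym_b bE.
by apply/esym/negbTE; rewrite -leqNgt ltnW // posE // invert_seq_arc -/b bE.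
Qed.
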